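(* Let $\mu>0$. Suppose the standing setting of the context holds (there is a solution of $\min_{w}\frac1K\sum_{k=1}^K J_k(w)+R(w)$; each $J_k$ is convex and differentiable with $\delta$-Lipschitz gradient; $\bar J=\frac1K\sum_k J_k$ is $\nu$-strongly convex with $0<\nu\le\delta$; $R$ is proper, lower-semicontinuous and convex). Then there exists a triple $(\mathbf w^\star,\mathbf y^\star,\mathbf z^\star)\in(\mathbb R^{KM})^3$ satisfying $$\begin{cases}\mathbf z^\star=\mathbf w^\star-\mu\nabla\mathcal J_\mu(\mathbf w^\star)-\mathcal B^{1/2}\mathbf y^\star,\\ 0=\mathcal B^{1/2}\mathbf z^\star,\\ \mathbf w^\star=\mathrm{prox}_{\mu\mathcal R}(\mathbf z^\star).\end{cases}$$ Moreover, $\mathbf w^\star$ and $\mathbf z^\star$ are unique (i.e. they are the same for all triples satisfying this system), and, writing $\mathbf w^\star=\mathrm{col}\{w_1^\star,\dots,w_K^\star\}$ with $w_k^\star\in\mathbb R^M$, one has $w_k^\star=w^\star$ for all $k=1,\dots,K$, where $w^\star$ is the unique minimizer of $\frac1K\sum_{k=1}^K J_k(w)+R(w)$ over $w\in\mathbb R^M$.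
   Context: Setting. $J_1,\dots,J_K:\mathbb R^M\to\mathbb R$ are convex and differentiable with $\|\nabla J_k(u)-\nabla J_k(v)\|\le\delta\|u-v\|$ for all $u,v$; $\bar J(w)=\frac1K\sum_{k=1}^K J_k(w)$ satisfies $(u-v)^{\top}(\nabla\bar J(u)-\nabla\bar J(v))\ge\nu\|u-v\|^2$ for all $u,v$, with $0<\nu\le\delta$. $R:\mathbb R^M\to\mathbb R\cup\{\infty\}$ is proper, lower-semicontinuous and convex (not necessarily differentiable). The problem $\min_{w\in\mathbb R^M}\frac1K\sum_k J_k(w)+R(w)$ has a solution $w^\star$ (unique by strong convexity). $A\in\mathbb R^{K\times K}$ is the weight matrix of the network: symmetric, doubly stochastic (nonnegative entries, $A\mathbf 1_K=\mathbf 1_K$ and $\mathbf 1_K^{\top}A=\mathbf 1_K^{\top}$) and primitive (some power $A^p$ has all entries positive). $\mathcal B=\frac12(I_{KM}-A\otimes I_M)$, which is symmetric positive semidefinite, and $\mathcal B^{1/2}$ is its positive semidefinite square root. For $\mathbf w=\mathrm{col}\{w_1,\dots,w_K\}\in\mathbb R^{KM}$ (stacking of $w_k\in\mathbb R^M$): $\mathcal J(\mathbf w)=\sum_{k=1}^K J_k(w_k)$, $\mathcal R(\mathbf w)=\sum_{k=1}^K R(w_k)$, and $\mathcal J_\mu(\mathbf w)=\mathcal J(\mathbf w)+\frac1{2\mu}\|\mathcal B^{1/2}\mathbf w\|^2$. The proximal operator is $\mathrm{prox}_{\mu f}(x)=\arg\min_z\{f(z)+\frac1{2\mu}\|z-x\|^2\}$.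 *)

(* Defs.v *)
From HB Require Import structures.
From mathcomp Require Export all_boot all_order all_algebra.
From mathcomp Require Export mxtens.
From mathcomp Require Export all_classical all_reals all_analysis.
Export Order.TTheory GRing.Theory Num.Theory.
Export numFieldNormedType.Exports.

Set Implicit Arguments.
Unset Strict Implicit.
Unset Printing Implicit Defensive.

Local Open Scope classical_set_scope.
Local Open Scope ring_scope.

Definition dotv (R : realType) (n : nat) (u v : 'cV[R]_n) : R :=
  (u^T *m v) 0 0.

(* The library norm `|_| on matrices is the sup norm, hence a separate
   Euclidean norm. *)
Definition norm2 (R : realType) (n : nat) (u : 'cV[R]_n) : R :=
  Num.sqrt (dotv u u).

(* Vector of partial derivatives; this is the gradient where f is
   differentiable. *)
Definition grad (R : realType) (n : nat) (f : 'cV[R]_n -> R) (x : 'cV[R]_n) :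
    'cV[R]_n :=
  \col_(i < n) 'D_(delta_mx i 0) f x.

Definition symmetric_psd (R : realType) (n : nat) (S : 'M[R]_n) : Prop :=
  S^T = S /\ forall x : 'cV[R]_n, 0 <= dotv x (S *m x).

(* The positive semidefinite square root (0 if B has none, i.e. if B is not
   itself symmetric positive semidefinite). *)
Definition psd_sqrt (R : realType) (n : nat) (B : 'M[R]_n) : 'M[R]_n :=
  xget 0 [set S : 'M[R]_n | symmetric_psd S /\ S *m S = B].

Definition argmin (R : realType) (T : Type) (f : T -> \bar R) : set T :=
  [set x | forall y, (f x <= f y)%E].

(* Set-valued: "w = prox_{mu f}(x)" reads prox mu f x = [set w], i.e. w is the
   one and only minimizer. *)
Definition prox (R : realType) (n : nat) (mu : R) (f : 'cV[R]_n -> \bar R)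
    (x : 'cV[R]_n) : set 'cV[R]_n :=
  argmin (fun z => (f z + ((2 * mu)^-1 * norm2 (z - x) ^+ 2)%:E)%E).

(* Functions into R \cup {+oo} are functions into \bar R avoiding -oo. *)
Definition eproper (R : realType) (T : Type) (f : T -> \bar R) : Prop :=
  (forall x, f x <> -oo%E) /\ exists x, f x <> +oo%E.

Definition econvex (R : realType) (n : nat) (f : 'cV[R]_n -> \bar R) : Prop :=
  forall (x y : 'cV[R]_n) (t : R), 0 <= t -> t <= 1 ->
    (f (t *: x + (1 - t) *: y)%R <= t%:E * f x + (1 - t)%:E * f y)%E.

Definition doubly_stochastic (R : realType) (K : nat) (A : 'M[R]_K) : Prop :=
  [/\ forall i j, 0 <= A i j,
      A *m (const_mx 1 : 'cV_K) = const_mx 1 &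
      (const_mx 1 : 'rV_K) *m A = const_mx 1].

Definition primitive_mx (R : realType) (K : nat) (A : 'M[R]_K) : Prop :=
  exists2 p : nat, (0 < p)%N & forall i j, 0 < (A ^+ p) i j.

(* k-th block w_k of w = col{w_1, ..., w_K}; mxtens_index (k, i) = k * M + i is
   the indexing used by the Kronecker product *t. *)
Definition block (R : realType) (K M : nat) (w : 'cV[R]_(K * M)) (k : 'I_K) :
    'cV[R]_M :=
  \col_(i < M) w (mxtens_index (k, i)) 0.

Definition mean_cost (R : realType) (K M : nat) (J : 'I_K -> 'cV[R]_M -> R)
    (w : 'cV[R]_M) : R :=
  K%:R^-1 * \sum_(k < K) J k w.

Definition objective (R : realType) (K M : nat) (J : 'I_K -> 'cV[R]_M -> R)
    (r : 'cV[R]_M -> \bar R) (w : 'cV[R]_M) : \bar R :=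
  ((mean_cost J w)%:E + r w)%E.

Definition netB (R : realType) (K : nat) (A : 'M[R]_K) (M : nat) :
    'M[R]_(K * M) :=
  2^-1 *: (1%:M - A *t (1%:M : 'M[R]_M)).

Definition netJ (R : realType) (K M : nat) (J : 'I_K -> 'cV[R]_M -> R)
    (w : 'cV[R]_(K * M)) : R :=
  \sum_(k < K) J k (block w k).

Definition netR (R : realType) (K M : nat) (r : 'cV[R]_M -> \bar R)
    (w : 'cV[R]_(K * M)) : \bar R :=
  (\sum_(k < K) r (block w k))%E.

Definition netJmu (R : realType) (K M : nat) (A : 'M[R]_K) (mu : R)
    (J : 'I_K -> 'cV[R]_M -> R) (w : 'cV[R]_(K * M)) : R :=
  netJ J w + (2 * mu)^-1 * norm2 (psd_sqrt (netB A M) *m w) ^+ 2.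

Definition fixed_point (R : realType) (K M : nat) (A : 'M[R]_K) (mu : R)
    (J : 'I_K -> 'cV[R]_M -> R) (r : 'cV[R]_M -> \bar R)
    (w y z : 'cV[R]_(K * M)) : Prop :=
  [/\ z = w - mu *: grad (netJmu A mu J) w - psd_sqrt (netB A M) *m y,
      0 = psd_sqrt (netB A M) *m z &
      prox mu (@netR R K M r) z = [set w]].

(* Main.v *)
Require Import Defs.
From mathcomp Require Import perm ring lra.

(** Write [S] for the positive semidefinite square root of
    [B = (1 - A (x) 1) / 2].  Since [S] is symmetric with [S S = B], it has the
    kernel of [B]; as [A] is primitive and stochastic, this kernel is the
    consensus space, the vectors with all blocks equal (lemmas
    [ker_netB_sqrt_consensus] and [consensus_ker_netB_sqrt]).  The range of [S]
    is its orthogonal complement, the vectors whose blocks sum to zero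
    ([netB_sqrt_sum_block], [netB_sqrt_range]).  These facts turn the fixed
    point system into the optimality condition of the aggregate problem,
    [- grad Jbar a] is a subgradient of [r] at [a], called [stationary] below.

    From a fixed point [(w, y, z)] to a stationary point: [S z = 0] makes [z] a
    consensus vector, and then so is [w], because exchanging two blocks
    preserves the proximal objective and hence its only minimizer.  On
    consensus vectors the penalty in [netJmu] has zero gradient, and summing
    the blocks of the first equation removes the term [S y]; what remains is
    [z_k = a - mu grad Jbar a], where [a] is the common block of [w].  The
    first-order condition for the proximal problem now reads: [a] is
    stationary.

    Conversely, for a stationary [a], the stacks of [a] and of
    [a - mu grad Jbar a] solve the second and third equations, and the residual
    of the first one has blocks that sum to zero, so some [y] absorbs it.

    Strong monotonicity of [grad Jbar] leaves at most one stationary point, and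
    every minimizer of the aggregate objective is stationary.  So the assumed
    minimizer is the only one, it yields a fixed point, and it determines [w]
    and [z] for every fixed point. *)

Set Implicit Arguments.
Unset Strict Implicit.
Unset Printing Implicit Defensive.

Local Open Scope classical_set_scope.
Local Open Scope ring_scope.

(** * The Euclidean inner product *)

Section Dot.
Variables (R : realType) (n : nat).
Implicit Types (u v w : 'cV[R]_n) (S : 'M[R]_n).

Lemma dotvE u v : dotv u v = \sum_i u i 0 * v i 0.
Proof. by rewrite /dotv mxE; apply: eq_bigr => i _; rewrite mxE. Qed.

Lemma dotvC u v : dotv u v = dotv v u.
Proof. by rewrite !dotvE; apply: eq_bigr => i _; rewrite mulrC. Qed.

Lemma dotvDr u v w : dotv u (v + w) = dotv u v + dotv u w.
Proof. by rewrite /dotv mulmxDr mxE. Qed.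

Lemma dotvZr c u v : dotv u (c *: v) = c * dotv u v.
Proof. by rewrite /dotv -scalemxAr mxE. Qed.

Lemma dotvDl u v w : dotv (v + w) u = dotv v u + dotv w u.
Proof. by rewrite dotvC dotvDr ![dotv u _]dotvC. Qed.

Lemma dotvZl c u v : dotv (c *: u) v = c * dotv u v.
Proof. by rewrite dotvC dotvZr dotvC. Qed.

Lemma dotvNr u v : dotv u (- v) = - dotv u v.
Proof. by rewrite -scaleN1r dotvZr mulN1r. Qed.

Lemma dotvNl u v : dotv (- u) v = - dotv u v.
Proof. by rewrite dotvC dotvNr dotvC. Qed.

Lemma dotvBr u v w : dotv u (v - w) = dotv u v - dotv u w.
Proof. by rewrite dotvDr dotvNr. Qed.

Lemma dotvBl u v w : dotv (v - w) u = dotv v u - dotv w u.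
Proof. by rewrite dotvDl dotvNl. Qed.

Lemma dotv0 u : dotv u 0 = 0.
Proof. by rewrite /dotv mulmx0 mxE. Qed.

Lemma dotv_suml (I : finType) (F : I -> 'cV[R]_n) v :
  dotv (\sum_k F k) v = \sum_k dotv (F k) v.
Proof. by rewrite /dotv linear_sum /= mulmx_suml summxE. Qed.

Lemma dotv_sumr (I : finType) (F : I -> 'cV[R]_n) v :
  dotv v (\sum_k F k) = \sum_k dotv v (F k).
Proof. by rewrite dotvC dotv_suml; apply: eq_bigr => k _; rewrite dotvC. Qed.

Lemma dotv_ge0 u : 0 <= dotv u u.
Proof. by rewrite dotvE sumr_ge0 // => i _; rewrite -expr2 sqr_ge0. Qed.

Lemma dotv_eq0 u : dotv u u = 0 -> u = 0.
Proof.
rewrite dotvE => u0; apply/colP => i; rewrite mxE.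
have sq_ge0 (j : 'I_n) : true -> 0 <= u j 0 * u j 0.
  by rewrite -expr2 sqr_ge0.
have /eqP : u i 0 * u i 0 = 0 := psumr_eq0P sq_ge0 u0 isT.
by rewrite mulf_eq0 orbb => /eqP.
Qed.

Lemma norm2_sqr u : norm2 u ^+ 2 = dotv u u.
Proof. by rewrite /norm2 sqr_sqrtr // dotv_ge0. Qed.

Lemma dotv_adjoint S u v : dotv (S *m u) v = dotv u (S^T *m v).
Proof. by rewrite /dotv trmx_mul mulmxA. Qed.

End Dot.

Lemma row_sum_const1 (R : realType) (n : nat) (T : 'M[R]_n) i :
  T *m (const_mx 1 : 'cV_n) = const_mx 1 -> \sum_j T i j = 1.
Proof.
move=> /colP/(_ i); rewrite !mxE => <-.
by apply: eq_bigr => j _; rewrite mxE mulr1.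
Qed.

(** * The square root of half the Laplacian of a stochastic matrix *)

Section PsdSqrt.
Variables (R : realType) (n : nat) (T : 'M[R]_n).
Hypothesis T_ge0 : forall i j, 0 <= T i j.
Hypothesis T_sym : T^T = T.
Hypothesis T_row : T *m (const_mx 1 : 'cV_n) = const_mx 1.

(** The unknown is [X = 1 - sqrt (1 - T)], which solves [X = (T + X^2) / 2].
    Iterating this equation from [0] gives an entrywise nondecreasing sequence
    of nonnegative matrices, because [T] has nonnegative entries; the row sums
    stay at most [1], because those of [T] are [1].  Hence it converges. *)
Definition cosqrt_iter (k : nat) : 'M[R]_n :=
  iter k (fun X => 2^-1 *: (T + X *m X)) 0.

Lemma cosqrt_iterS k i j : cosqrt_iter k.+1 i j =
  2^-1 * (T i j + \sum_l cosqrt_iter k i l * cosqrt_iter k l j).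
Proof. by rewrite /cosqrt_iter iterS !mxE. Qed.

Lemma cosqrt_iter_ge0 k i j : 0 <= cosqrt_iter k i j.
Proof.
elim: k i j => [|k IH] i j; first by rewrite /cosqrt_iter mxE.
rewrite cosqrt_iterS mulr_ge0 ?invr_ge0 ?ler0n// addr_ge0 ?sumr_ge0// => l _.
by rewrite mulr_ge0.
Qed.

Lemma cosqrt_iter_mono k i j : cosqrt_iter k i j <= cosqrt_iter k.+1 i j.
Proof.
elim: k i j => [|k IH] i j; first by rewrite [leLHS]mxE cosqrt_iter_ge0.
rewrite [leLHS]cosqrt_iterS [leRHS]cosqrt_iterS ler_wpM2l ?invr_ge0 ?ler0n//.
by rewrite lerD2l ler_sum // => l _; rewrite ler_pM ?cosqrt_iter_ge0.
Qed.

Lemma cosqrt_iter_sym k : (cosqrt_iter k)^T = cosqrt_iter k.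
Proof.
elim: k => [|k IH]; first by rewrite /cosqrt_iter trmx0.
rewrite /cosqrt_iter !iterS -/(cosqrt_iter k).
by rewrite linearZ linearD /= trmx_mul IH T_sym.
Qed.

Lemma cosqrt_iter_row_le1 k i : \sum_j cosqrt_iter k i j <= 1.
Proof.
elim: k i => [|k IH] i.
  by rewrite big1 ?ler01// => j _; rewrite /cosqrt_iter mxE.
under eq_bigr do rewrite cosqrt_iterS.
rewrite -mulr_sumr big_split /= row_sum_const1 // exchange_big /=.
have : \sum_l \sum_j cosqrt_iter k i l * cosqrt_iter k l j <= 1.
  apply: le_trans (IH i); apply: ler_sum => l _.
  by rewrite -mulr_sumr ler_piMr ?cosqrt_iter_ge0.
by lra.
Qed.

Lemma cosqrt_iter_le1 k i j : cosqrt_iter k i j <= 1.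
Proof.
apply: le_trans (cosqrt_iter_row_le1 k i).
by rewrite (bigD1 j) //= lerDl sumr_ge0 // => l _; rewrite cosqrt_iter_ge0.
Qed.

Definition cosqrt : 'M[R]_n := \matrix_(i, j) limn (fun k => cosqrt_iter k i j).

Lemma cosqrt_iter_cvg i j : cosqrt_iter k i j @[k --> \oo] --> cosqrt i j.
Proof.
rewrite mxE; apply: nondecreasing_is_cvgn.
  by apply/nondecreasing_seqP => k; exact: cosqrt_iter_mono.
by exists 1 => _ [k _ <-]; exact: cosqrt_iter_le1.
Qed.

Lemma cosqrt_fix : cosqrt = 2^-1 *: (T + cosqrt *m cosqrt).
Proof.
apply/matrixP => i j.
have /cvg_lim <- // : cosqrt_iter k i j @[k --> \oo] -->
    (2^-1 *: (T + cosqrt *m cosqrt)) i j.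
  rewrite -(cvg_shiftS (fun k => cosqrt_iter k i j)).
  under eq_fun do rewrite cosqrt_iterS.
  rewrite !mxE; apply: cvgMr; apply: cvgD; first exact: cvg_cst.
  apply: cvg_big => [|l _]; first by move=> x; exact: add_continuous.
  by apply: cvgM; exact: cosqrt_iter_cvg.
by rewrite mxE.
Qed.

Lemma cosqrt_ge0 i j : 0 <= cosqrt i j.
Proof.
apply: (cvgr_to_ge (@cosqrt_iter_cvg i j)); apply: nearW => k.
exact: cosqrt_iter_ge0.
Qed.

Lemma cosqrt_sym i j : cosqrt i j = cosqrt j i.
Proof.
rewrite !mxE; congr (limn _); apply/funext => k.
by rewrite -[in LHS]cosqrt_iter_sym mxE.
Qed.

Lemma cosqrt_row_le1 i : \sum_j cosqrt i j <= 1.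
Proof.
have : \sum_j cosqrt_iter k i j @[k --> \oo] --> \sum_j cosqrt i j.
  apply: cvg_big => [|l _]; first by move=> x; exact: add_continuous.
  exact: cosqrt_iter_cvg.
move/(@cvgr_to_le _ _ _ _ _ _ 1); apply; apply: nearW => k.
exact: cosqrt_iter_row_le1.
Qed.

(** Diagonal dominance: [2 x_i x_j <= x_i^2 + x_j^2], summed with the weights
    [cosqrt i j], whose rows and columns have sums at most [1]. *)
Lemma sub_cosqrt_psd (x : 'cV[R]_n) : 0 <= dotv x ((1%:M - cosqrt) *m x).
Proof.
rewrite mulmxBl mul1mx dotvBr subr_ge0 [leRHS]dotvE dotvE.
have row_bound : \sum_i x i 0 ^+ 2 * \sum_j cosqrt i j
    <= \sum_i x i 0 * x i 0.
  apply: ler_sum => i _; rewrite -expr2 ler_piMr ?sqr_ge0//.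
  exact: cosqrt_row_le1.
apply: le_trans row_bound.
(* By symmetry of the weights, half of the left side can be transposed. *)
have expand : \sum_i x i 0 ^+ 2 * (\sum_j cosqrt i j) =
    \sum_i \sum_j cosqrt i j * (2^-1 * (x i 0 ^+ 2 + x j 0 ^+ 2)).
  transitivity (2^-1 * (\sum_i \sum_j cosqrt i j * x i 0 ^+ 2 +
                        \sum_i \sum_j cosqrt i j * x j 0 ^+ 2)).
    rewrite [X in _ + X]exchange_big /=.
    have -> : \sum_j \sum_i cosqrt i j * x j 0 ^+ 2 =
              \sum_i \sum_j cosqrt i j * x i 0 ^+ 2.
      by apply: eq_bigr => i _; apply: eq_bigr => j _; rewrite cosqrt_sym.
    have -> : \sum_i x i 0 ^+ 2 * (\sum_j cosqrt i j) =
              \sum_i \sum_j cosqrt i j * x i 0 ^+ 2.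
      by apply: eq_bigr => i _; rewrite mulrC mulr_suml.
    by lra.
  rewrite -big_split mulr_sumr; apply: eq_bigr => i _ /=.
  rewrite -big_split mulr_sumr; apply: eq_bigr => j _ /=.
  by ring.
rewrite expand; apply: ler_sum => i _; rewrite mxE mulr_sumr.
apply: ler_sum => j _; have := cosqrt_ge0 i j; have := sqr_ge0 (x i 0 - x j 0).
by move=> ? ?; nra.
Qed.

(** [psd_sqrt B] is a choice among the positive semidefinite square roots of
    [B], so it suffices to exhibit one: [(1 - cosqrt) / sqrt 2]. *)
Lemma psd_sqrt_stochastic (B := 2^-1 *: (1%:M - T)) :
  symmetric_psd (psd_sqrt B) /\ psd_sqrt B *m psd_sqrt B = B.
Proof.
apply: (@xgetPex _ 0 [set S : 'M[R]_n | symmetric_psd S /\ S *m S = B]).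
have c_ge0 : 0 <= Num.sqrt (2^-1 : R) by exact: sqrtr_ge0.
exists (Num.sqrt 2^-1 *: (1%:M - cosqrt)); split; [split|].
- rewrite linearZ linearB /= trmx1; congr (_ *: (_ - _)).
  by apply/matrixP => i j; rewrite [LHS]mxE cosqrt_sym.
- by move=> x; rewrite -scalemxAl dotvZr mulr_ge0 // sub_cosqrt_psd.
- rewrite -scalemxAl -scalemxAr scalerA -expr2 sqr_sqrtr ?invr_ge0 ?ler0n//.
  rewrite /B; congr (_ *: _).
  rewrite mulmxBl mul1mx mulmxBr mulmx1.
  have TE : cosqrt + cosqrt = T + cosqrt *m cosqrt.
    rewrite {1 2}cosqrt_fix -scalerDl.
    by rewrite [X in X *: _](_ : _ = 1) ?scale1r//; lra.
  have -> : T = cosqrt + cosqrt - cosqrt *m cosqrt by rewrite TE addrK.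
  by rewrite -[LHS]addrA -opprD addrA.
Qed.

End PsdSqrt.

(** * Kernel and range of a symmetric matrix *)

Section Symmetric.
Variables (R : realType) (n : nat) (S : 'M[R]_n).
Hypothesis S_sym : S^T = S.

Lemma ker_sqr (x : 'cV[R]_n) : S *m S *m x = 0 -> S *m x = 0.
Proof.
move=> SSx; apply: dotv_eq0.
by rewrite dotv_adjoint S_sym mulmxA SSx dotv0.
Qed.

(** The columns of [cokermx S] lie in the kernel of [S], and being orthogonal to
    them is the rank-based criterion for [v^T] to be in the row space of [S],
    which is the range of [S] by symmetry. *)
Lemma range_orthogonal_ker (v : 'cV[R]_n) :
  (forall x, S *m x = 0 -> dotv v x = 0) -> exists y, S *m y = v.
Proof.
move=> v_perp; have : (v^T <= S)%MS.
  rewrite submxE; apply/eqP/rowP => j; rewrite [RHS]mxE.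
  have /v_perp : S *m col j (cokermx S) = 0.
    by rewrite colE mulmxA mulmx_coker mul0mx.
  by apply: etrans; rewrite dotvE mxE; apply: eq_bigr => k _; rewrite !mxE.
case/submxP => D vD; exists D^T.
by rewrite -[S]S_sym -trmx_mul -vD trmxK.
Qed.

End Symmetric.

(** * Block vectors *)

Section Blocks.
Variables (R : realType) (K M : nat).
Implicit Types (w : 'cV[R]_(K * M)).

Definition stack (G : 'I_K -> 'cV[R]_M) : 'cV[R]_(K * M) :=
  \col_p G (mxtens_unindex p).1 (mxtens_unindex p).2 0.

Lemma block_stack G k : block (stack G) k = G k.
Proof. by apply/colP => i; rewrite !mxE mxtens_indexK. Qed.

Lemma eq_block w w' : block w =1 block w' -> w = w'.
Proof.
move=> ww'; apply/colP => p; case: (mxtens_indexP p) => k i.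
by have /colP/(_ i) := ww' k; rewrite !mxE.
Qed.

Lemma blockD w w' k : block (w + w') k = block w k + block w' k.
Proof. by apply/colP => i; rewrite !mxE. Qed.

Lemma blockZ c w k : block (c *: w) k = c *: block w k.
Proof. by apply/colP => i; rewrite !mxE. Qed.

Lemma blockB w w' k : block (w - w') k = block w k - block w' k.
Proof. by apply/colP => i; rewrite !mxE. Qed.

Lemma sum_mxtens (F : 'I_(K * M) -> R) :
  \sum_p F p = \sum_k \sum_i F (mxtens_index (k, i)).
Proof.
rewrite (reindex (@mxtens_index K M)) /=; last first.
  exists (@mxtens_unindex K M) => p _.
    by rewrite mxtens_indexK.
  by rewrite mxtens_unindexK.
by rewrite pair_bigA; apply: eq_bigr => -[k i].
Qed.

Lemma dotv_block w w' : dotv w w' = \sum_k dotv (block w k) (block w' k).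
Proof.
rewrite dotvE sum_mxtens; apply: eq_bigr => k _.
by rewrite dotvE; apply: eq_bigr => i _; rewrite !mxE.
Qed.

Lemma block_tens1 (A : 'M[R]_K) w k :
  block ((A *t (1%:M : 'M[R]_M)) *m w) k = \sum_j A k j *: block w j.
Proof.
apply/colP => i; rewrite !mxE summxE sum_mxtens.
apply: eq_bigr => j _; rewrite (bigD1 i) //= big1 => [|l li].
  by rewrite tensmxE !mxE eqxx mulr1 addr0.
by rewrite tensmxE mxE eq_sym (negbTE li) mulr0 mul0r.
Qed.

End Blocks.

(** * The consensus space *)

(** Maximum principle: [c] is also fixed by [A ^+ p], so its largest entry is an
    average of all the entries with positive weights, which forces them all to
    be equal to it. *)
Lemma primitive_fixed_const (R : realType) (K : nat) (A : 'M[R]_K)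
    (c : 'cV[R]_K) : doubly_stochastic A -> primitive_mx A ->
  A *m c = c -> forall i j, c i 0 = c j 0.
Proof.
move=> [_ A1 _] [p _ Ap_gt0] Ac.
have fixp (x : 'cV[R]_K) : A *m x = x -> A ^+ p *m x = x.
  move=> Ax; elim: (p) => [|q IH]; first by rewrite expr0 mul1mx.
  by rewrite exprS -mulmxA IH.
suff c_max m : (forall k, c k 0 <= c m 0) -> forall k, c k 0 = c m 0.
  move=> i j.
  have [m _ m_max] := @arg_maxP _ _ _ i xpredT (fun k => c k 0) isT.
  have cm k : c k 0 = c m 0 by apply: c_max => l; exact: m_max.
  by rewrite !cm.
move=> m_max k.
have Pc := fixp _ Ac; have P1 := fixp _ A1.
have sum0 : \sum_j (A ^+ p) m j * (c m 0 - c j 0) = 0.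
  have /colP/(_ m) := Pc; rewrite mxE => sc.
  under eq_bigr do rewrite mulrBr.
  by rewrite sumrB sc -mulr_suml row_sum_const1 // mul1r subrr.
have ge0 (j : 'I_K) : true -> 0 <= (A ^+ p) m j * (c m 0 - c j 0).
  by move=> _; rewrite mulr_ge0 ?subr_ge0// ltW.
have /eqP : (A ^+ p) m k * (c m 0 - c k 0) = 0 := psumr_eq0P ge0 sum0 isT.
by rewrite mulf_eq0 gt_eqF //= subr_eq0 => /eqP.
Qed.

Section NetworkSqrt.
Variables (R : realType) (K M : nat) (A : 'M[R]_K).
Hypothesis A_sym : A^T = A.
Hypothesis A_ds : doubly_stochastic A.

Let S := psd_sqrt (netB A M).

Lemma block_netB (w : 'cV[R]_(K * M)) k :
  block (netB A M *m w) k = 2^-1 *: (block w k - \sum_j A k j *: block w j).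
Proof.
by rewrite /netB -scalemxAl mulmxBl mul1mx blockZ blockB block_tens1.
Qed.

Let A_row_sum k : \sum_j A k j = 1.
Proof. by apply: row_sum_const1; case: A_ds. Qed.

Lemma netB_sqrt : symmetric_psd S /\ S *m S = netB A M.
Proof.
apply: psd_sqrt_stochastic.
- move=> p q; case: (mxtens_indexP p) => k i; case: (mxtens_indexP q) => j l.
  by rewrite tensmxE mulr_ge0 // ?mxE ?ler0n//; case: A_ds.
- by rewrite trmx_tens A_sym trmx1.
- apply: eq_block => k; rewrite block_tens1.
  have block1 j : block (const_mx 1) j = const_mx 1 :> 'cV[R]_M.
    by apply/colP => i; rewrite !mxE.
  under eq_bigr do rewrite block1.
  by rewrite block1 -scaler_suml A_row_sum scale1r.
Qed.

Lemma netB_sqrt_sym : S^T = S.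
Proof. by case: netB_sqrt => -[]. Qed.

Lemma ker_netB_sqrt_consensus (w : 'cV[R]_(K * M)) : primitive_mx A ->
  S *m w = 0 -> forall k l, block w k = block w l.
Proof.
move=> A_prim Sw0 k l; apply/colP => i.
have Bw0 : netB A M *m w = 0 by rewrite -netB_sqrt.2 -mulmxA Sw0 mulmx0.
pose c : 'cV[R]_K := \col_j block w j i 0.
suff /(primitive_fixed_const A_ds A_prim)/(_ k l) : A *m c = c.
  by rewrite !mxE.
apply/colP => j; have := block_netB w j; rewrite Bw0 => /colP/(_ i).
rewrite !mxE => /esym/eqP; rewrite mulf_eq0 invr_eq0 pnatr_eq0 /=.
rewrite subr_eq0 => /eqP ->; rewrite summxE; apply: eq_bigr => m _.
by rewrite !mxE.
Qed.

Lemma consensus_ker_netB_sqrt (a : 'cV[R]_M) : S *m stack (fun _ => a) = 0.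
Proof.
apply: ker_sqr; first exact: netB_sqrt_sym.
rewrite netB_sqrt.2; apply: eq_block => k; rewrite block_netB.
under eq_bigr do rewrite block_stack.
rewrite block_stack -scaler_suml A_row_sum scale1r subrr scaler0.
by apply/colP => i; rewrite !mxE.
Qed.

(** The range of a symmetric matrix is orthogonal to its kernel, which contains
    the stacked constant [a]; taking for [a] the sum of the blocks itself makes
    its squared length vanish. *)
Lemma netB_sqrt_sum_block (y : 'cV[R]_(K * M)) :
  \sum_k block (S *m y) k = 0.
Proof.
apply: dotv_eq0; set a := \sum_k _.
have {1}-> : dotv a a = dotv (S *m y) (stack (fun _ => a)).
  rewrite dotv_block; under eq_bigr do rewrite block_stack.
  by rewrite -dotv_suml.
by rewrite dotv_adjoint netB_sqrt_sym consensus_ker_netB_sqrt dotv0.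
Qed.

(** This is what produces the dual variable: the kernel is exactly the consensus
    space, so its orthogonal complement consists of the vectors whose blocks sum
    to zero. *)
Lemma netB_sqrt_range (v : 'cV[R]_(K * M)) : primitive_mx A -> (0 < K)%N ->
  \sum_k block v k = 0 -> exists y, S *m y = v.
Proof.
move=> A_prim K_gt0 v0; apply: range_orthogonal_ker => [|x Sx0].
  exact: netB_sqrt_sym.
have x_cons := ker_netB_sqrt_consensus A_prim Sx0.
rewrite dotv_block.
under eq_bigr => k _ do rewrite (x_cons k (Ordinal K_gt0)).
by rewrite -dotv_suml v0 dotvC dotv0.
Qed.

End NetworkSqrt.

(** * Gradients *)

Section Gradient.
Variables (R : realType) (n : nat).

Lemma is_derive_grad (f : 'cV[R]_n -> R) (x v : 'cV[R]_n) :
  differentiable f x -> is_derive x v f (dotv v (grad f x)).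
Proof.
move=> df; split; first exact: diff_derivable.
rewrite deriveE // dotvE {1}[v]matrix_sum_delta linear_sum /=.
apply: eq_bigr => i _; rewrite big_ord1 linearZ /= mxE deriveE //.
Qed.

Lemma grad_eq (f : 'cV[R]_n -> R) (x g : 'cV[R]_n) :
  (forall v, is_derive x v f (dotv v g)) -> grad f x = g.
Proof.
move=> fg; apply/colP => i; rewrite mxE (@derive_val _ _ _ _ _ _ _ (fg _)).
rewrite dotvE (bigD1 i) //= big1 => [|j ji].
  by rewrite mxE !eqxx mul1r addr0.
by rewrite mxE (negbTE ji) mul0r.
Qed.

(** The difference quotient is exactly [d + h * e]. *)
Lemma is_derive_quadratic_expansion (f : 'cV[R]_n -> R) (x v : 'cV[R]_n) d e :
  (forall h, f (h *: v + x) = f x + h * d + h ^+ 2 * e) -> is_derive x v f d.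
Proof.
move=> f_line.
have cvg_quot : h^-1 *: ((f \o shift x) (h *: v) - f x) @[h --> 0^'] --> d.
  have : d + h * e @[h --> (0 : R)^'] --> d.
    rewrite -[X in _ --> X]addr0 -[X in _ + X](mul0r e).
    apply: cvgD; first exact: cvg_cst.
    by apply: cvgMl; exact: cvg_within.
  apply: cvg_trans; apply: near_eq_cvg; near=> h.
  have h0 : h != 0 by near: h; exact: nbhs_dnbhs_neq.
  by rewrite /= f_line /GRing.scale /=; field.
by split; [exact: cvgP cvg_quot | exact: cvg_lim].
Unshelve. all: by end_near. Qed.

Lemma is_derive_norm2_affine m (S : 'M[R]_(m, n)) (z : 'cV[R]_m)
    (x v : 'cV[R]_n) :
  is_derive x v (fun u => norm2 (S *m u - z) ^+ 2)
    (2 * dotv (S *m v) (S *m x - z)).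
Proof.
apply: (@is_derive_quadratic_expansion _ _ _ _ (dotv (S *m v) (S *m v))) => h.
rewrite mulmxDr -scalemxAr -addrA !norm2_sqr.
move: (S *m v) (S *m x - z) => a b.
rewrite dotvDl !dotvDr !dotvZl !dotvZr (dotvC b a).
by ring.
Qed.

End Gradient.

Section NetworkGradient.
Variables (R : realType) (K M : nat) (J : 'I_K -> 'cV[R]_M -> R).
Hypothesis J_diff : forall k x, differentiable (J k) x.

Lemma is_derive_mean_cost_sum x v :
  is_derive x v (mean_cost J) (dotv v (K%:R^-1 *: \sum_k grad (J k) x)).
Proof.
have -> : mean_cost J = K%:R^-1 *: (\sum_(k < K) J k).
  by apply/funext => w; rewrite /mean_cost fctE fct_sumE.
rewrite dotvZr dotv_sumr.
by apply: is_deriveZ; apply: is_derive_sum => k; exact: is_derive_grad.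
Qed.

Lemma grad_mean_cost x :
  grad (mean_cost J) x = K%:R^-1 *: \sum_k grad (J k) x.
Proof. by apply: grad_eq => v; exact: is_derive_mean_cost_sum. Qed.

Lemma is_derive_mean_cost x v :
  is_derive x v (mean_cost J) (dotv v (grad (mean_cost J) x)).
Proof. by rewrite grad_mean_cost; exact: is_derive_mean_cost_sum. Qed.

(** Extracting a block is linear, so the two difference quotients are the same
    function of the increment. *)
Lemma is_derive_block (g : 'cV[R]_M -> R) (k : 'I_K) (w v : 'cV[R]_(K * M)) d :
  is_derive (block w k) (block v k) g d ->
  is_derive w v (fun u => g (block u k)) d.
Proof.
have quotE : (fun h : R => h^-1 *: (((fun u => g (block u k)) \o shift w)
      (h *: v) - g (block w k))) =
    (fun h => h^-1 *: ((g \o shift (block w k)) (h *: block v k)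
      - g (block w k))).
  by apply/funext => h /=; rewrite blockD blockZ.
by case=> dg gd; split; [rewrite /derivable quotE | rewrite /derive quotE].
Qed.

(** On the kernel of [S] the quadratic penalty is at its minimum, zero, and
    contributes nothing to the gradient. *)
Lemma grad_netJmu (A : 'M[R]_K) (mu : R) (w : 'cV[R]_(K * M)) :
  let S := psd_sqrt (netB A M) in
  S *m w = 0 ->
  grad (netJmu A mu J) w = stack (fun k => grad (J k) (block w k)).
Proof.
move=> S Sw0; apply: grad_eq => v.
have -> : dotv v (stack (fun k => grad (J k) (block w k))) =
    \sum_k dotv (block v k) (grad (J k) (block w k)).
  by rewrite dotv_block; apply: eq_bigr => k _; rewrite block_stack.
rewrite -[X in is_derive _ _ _ X]addr0.
have -> : netJmu A mu J = (\sum_(k < K) (fun u => J k (block u k))) +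
    (2 * mu)^-1 *: (fun u => norm2 (S *m u - 0) ^+ 2).
  by apply/funext => u; rewrite !fctE fct_sumE subr0.
apply: is_deriveD.
  by apply: is_derive_sum => k; apply: is_derive_block; exact: is_derive_grad.
have -> : 0 = (2 * mu)^-1 *: (2 * dotv (S *m v) (S *m w - 0)).
  by rewrite Sw0 subr0 dotv0 mulr0 scaler0.
by apply: is_deriveZ; exact: is_derive_norm2_affine.
Qed.

End NetworkGradient.

(** * First-order conditions and the proximal operator *)

Section FirstOrder.
Variables (R : realType) (n : nat) (f : 'cV[R]_n -> \bar R).
Hypothesis f_proper : eproper f.

Lemma argmin_finite (g : 'cV[R]_n -> R) a :
  argmin (fun x => f x + (g x)%:E)%E a -> exists s, f a = s%:E.
Proof.
case: f_proper => f_ny [x0 fx0] /(_ x0).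
have := f_ny a; have := f_ny x0; move: fx0.
case: (f a) => [s| |] //; first by exists s.
by case: (f x0).
Qed.

(** Minimality of [a] against the points [a + h (u - a)] for small [h > 0],
    combined with the convexity of [f] on that segment, bounds the difference
    quotient of [g] below by [f a - f u]; then [h] tends to [0]. *)
Lemma argmin_first_order (g : 'cV[R]_n -> R) a u d : econvex f ->
  argmin (fun x => f x + (g x)%:E)%E a -> is_derive a (u - a) g d ->
  (f a <= f u + d%:E)%E.
Proof.
move=> f_conv a_min [dg gd]; have [s fa] := argmin_finite a_min.
have [f_ny _] := f_proper.
case fu : (f u) (f_ny u) => [t| |] // _; last by rewrite addye ?leey.
rewrite fa -EFinD lee_fin -lerBlDl -gd.
have quot_cvg := cvg_dnbhs_at_right dg.
rewrite /derive; apply: (cvgr_to_ge quot_cvg).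
near=> h; have h_gt0 : 0 < h by [].
have h_le1 : h <= 1 by near: h; apply: nbhs_right_le.
have := f_conv u a h (ltW h_gt0) h_le1.
have -> : h *: u + (1 - h) *: a = h *: (u - a) + a.
  by rewrite scalerBr scalerBl scale1r addrCA addrC.
have := a_min (h *: (u - a) + a).
rewrite fa fu /= -EFinD.
case: (f _) (f_ny (h *: (u - a) + a)) => [q| |] // _.
rewrite -!EFinM -!EFinD !lee_fin => min_le conv_le.
rewrite /GRing.scale /= ler_pdivlMl //.
by nra.
Unshelve. all: by end_near. Qed.

End FirstOrder.

(** If [(z - w) / mu] is a subgradient of [f] at [w], then the proximal
    objective grows at least like [|u - w|^2 / (2 mu)] around [w], which gives
    minimality and uniqueness at once. *)
Lemma prox_subgradient (R : realType) (n : nat) (f : 'cV[R]_n -> \bar R)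
    (mu : R) (w z : 'cV[R]_n) (s : R) : 0 < mu -> f w = s%:E ->
  (forall u, (s + mu^-1 * dotv (z - w) (u - w))%:E <= f u)%E ->
  prox mu f z = [set w].
Proof.
move=> mu_gt0 fw f_sub.
have c_gt0 : 0 < (2 * mu)^-1 by rewrite invr_gt0 mulr_gt0.
have quadE u : (2 * mu)^-1 * norm2 (u - z) ^+ 2 =
    (2 * mu)^-1 * norm2 (w - z) ^+ 2
    - mu^-1 * dotv (z - w) (u - w) + (2 * mu)^-1 * dotv (u - w) (u - w).
  have -> : u - z = (u - w) - (z - w) by rewrite opprB addrA subrK.
  rewrite -(opprB z w) !norm2_sqr.
  move: (u - w) (z - w) => a b.
  rewrite dotvNl dotvNr opprK dotvBl !dotvBr (dotvC a b).
  by field; rewrite gt_eqF.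
(* [quadE] turns the subgradient inequality into quadratic growth at [w]. *)
have growth u : (s%:E + ((2 * mu)^-1 * norm2 (w - z) ^+ 2)%:E +
    ((2 * mu)^-1 * dotv (u - w) (u - w))%:E <=
    f u + ((2 * mu)^-1 * norm2 (u - z) ^+ 2)%:E)%E.
  have := f_sub u; rewrite (quadE u).
  case: (f u) => [t| |] //; last by rewrite addye ?leey.
  by rewrite -!EFinD !lee_fin; lra.
rewrite /prox; apply/seteqP; split => u /=.
  move=> /(_ w); rewrite fw => /(le_trans (growth u)).
  rewrite -!EFinD lee_fin => le0.
  have /dotv_eq0/eqP : dotv (u - w) (u - w) = 0.
    by apply/eqP; rewrite eq_le dotv_ge0 andbT -(pmulr_rle0 _ c_gt0); lra.
  by rewrite subr_eq0 => /eqP.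
move=> -> u'; apply: le_trans (growth u').
by rewrite fw -!EFinD lee_fin lerDl mulr_ge0 ?dotv_ge0// ltW.
Qed.

(** * The optimality condition of the aggregate problem *)

Section Aggregate.
Variables (R : realType) (M : nat) (Jbar : 'cV[R]_M -> R).
Variables (r : 'cV[R]_M -> \bar R) (nu : R).
Hypothesis nu_gt0 : 0 < nu.
Hypothesis Jbar_strong : forall u v : 'cV[R]_M,
  nu * norm2 (u - v) ^+ 2 <= dotv (u - v) (grad Jbar u - grad Jbar v).
Hypothesis r_proper : eproper r.

(** [- grad Jbar a] is a subgradient of [r] at [a], written without subtraction
    so as to make sense when [r] takes the value [+oo]. *)
Definition stationary (a : 'cV[R]_M) : Prop :=
  forall u, (r a <= r u + (dotv (u - a) (grad Jbar a))%:E)%E.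

Lemma stationary_finite a : stationary a -> exists s, r a = s%:E.
Proof.
case: r_proper => r_ny [x0 rx0] /(_ x0).
have := r_ny a; have := r_ny x0; move: rx0.
case: (r a) => [s| |] //; first by exists s.
by case: (r x0).
Qed.

(** Adding the two subgradient inequalities, each tested at the other point,
    makes the strongly monotone pairing nonpositive. *)
Lemma stationary_unique a b : stationary a -> stationary b -> a = b.
Proof.
move=> sa sb; have [s ra] := stationary_finite sa.
have [t rb] := stationary_finite sb.
have := sa b; have := sb a; rewrite ra rb -!EFinD !lee_fin => ab ba.
have := Jbar_strong a b; rewrite norm2_sqr (dotvBr _ (grad _ _)) => strong.
have opp : dotv (b - a) (grad Jbar a) = - dotv (a - b) (grad Jbar a).
  by rewrite -opprB dotvNl.
apply/eqP; rewrite -subr_eq0; apply/eqP/dotv_eq0/eqP.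
rewrite eq_le dotv_ge0 andbT -(pmulr_rle0 _ nu_gt0).
by apply: le_trans strong _; lra.
Qed.

End Aggregate.

Lemma sume_const (R : realType) (K : nat) (s : R) :
  (\sum_(k < K) s%:E = (K%:R * s)%:E)%E.
Proof. by rewrite sumEFin sumr_const card_ord mulr_natl. Qed.

(** * The proximal operator of the network regularizer *)

Section NetworkProx.
Variables (R : realType) (K M : nat) (mu : R) (r : 'cV[R]_M -> \bar R).
Hypothesis K_gt0 : (0 < K)%N.

Lemma netR_stack (a : 'cV[R]_M) :
  netR r (stack (fun _ : 'I_K => a)) = (\sum_(k < K) r a)%E.
Proof. by apply: eq_bigr => k _; rewrite block_stack. Qed.

(** Around a consensus point the proximal objective is invariant under
    exchanging two blocks, so its unique minimizer is invariant too. *)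
Lemma prox_netR_consensus (w : 'cV[R]_(K * M)) (z0 : 'cV[R]_M) :
  prox mu (@netR R K M r) (stack (fun _ => z0)) = [set w] ->
  forall k l, block w k = block w l.
Proof.
move=> w_prox k l; set z := stack _ in w_prox.
(* [w] with its blocks [k] and [l] exchanged *)
pose s := tperm k l; pose ws := stack (fun i => block w (s i)).
have obj_ws : (netR r ws + ((2 * mu)^-1 * norm2 (ws - z) ^+ 2)%:E =
    netR r w + ((2 * mu)^-1 * norm2 (w - z) ^+ 2)%:E)%E.
  congr (_ + (_ * _)%:E)%E.
    rewrite /netR [RHS](reindex_inj (@perm_inj _ s)) /=.
    by apply: eq_bigr => i _; rewrite block_stack.
  rewrite !norm2_sqr !dotv_block [RHS](reindex_inj (@perm_inj _ s)) /=.
  by apply: eq_bigr => i _; rewrite !blockB !block_stack.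
have wE : [set w] w by [].
have : [set w] ws.
  rewrite -w_prox in wE *; move=> u.
  by have := wE u; rewrite -obj_ws.
move=> /= ws_w.
by rewrite -[in LHS]ws_w block_stack /s tpermL.
Qed.

(** On consensus vectors the network objective is [K] times the one-agent
    objective. *)
Lemma prox_netR_argmin (a z0 : 'cV[R]_M) : eproper r ->
  prox mu (@netR R K M r) (stack (fun _ => z0)) = [set stack (fun _ => a)] ->
  argmin (fun u => r u + ((2 * mu)^-1 * norm2 (u - z0) ^+ 2)%:E)%E a.
Proof.
move=> [r_ny _] w_prox u.
have : prox mu (@netR R K M r) (stack (fun _ => z0)) (stack (fun _ => a)).
  by rewrite w_prox.
move=> /(_ (stack (fun _ => u))); rewrite !netR_stack.
have normE (b : 'cV[R]_M) :
    norm2 (stack (fun _ : 'I_K => b) - stack (fun _ => z0)) ^+ 2 =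
    K%:R * norm2 (b - z0) ^+ 2.
  rewrite !norm2_sqr dotv_block mulr_natl -[in RHS](card_ord K) -sumr_const.
  by apply: eq_bigr => k _; rewrite blockB !block_stack.
rewrite !normE.
case ru : (r u) (r_ny u) => [t| |] // _; last by rewrite addye ?leey.
(* If [r a] were infinite, so would be the minimum of the network objective,
   which is finite at the stack of [u]. *)
case ra : (r a) (r_ny a) => [s| |] // _; last first.
  rewrite sume_const (bigD1 (Ordinal K_gt0)) //= !addye //.
  by rewrite gt_eqF // (@lt_le_trans _ _ 0%E) ?ltNyr // sume_ge0.
rewrite !sume_const -!EFinD !lee_fin.
rewrite !(mulrCA _ K%:R) -!mulrDr ler_pM2l ?ltr0n//.
Qed.

End NetworkProx.

(** * Fixed points and stationary points *)

Section FixedPoints.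
Variables (R : realType) (K M : nat) (mu : R) (J : 'I_K -> 'cV[R]_M -> R).
Variables (r : 'cV[R]_M -> \bar R) (A : 'M[R]_K).
Hypothesis K_gt0 : (0 < K)%N.
Hypothesis mu_gt0 : 0 < mu.
Hypothesis J_diff : forall k x, differentiable (J k) x.
Hypothesis r_proper : eproper r.
Hypothesis r_convex : econvex r.
Hypothesis A_sym : A^T = A.
Hypothesis A_ds : doubly_stochastic A.
Hypothesis A_prim : primitive_mx A.

Let gradJ := grad (mean_cost J).
Let K_neq0 : K%:R != 0 :> R. Proof. by rewrite pnatr_eq0 -lt0n. Qed.

Lemma sum_gradE a : \sum_k grad (J k) a = K%:R *: gradJ a.
Proof. by rewrite /gradJ grad_mean_cost // scalerA divff // scale1r. Qed.

(** Summing the blocks of the first equation eliminates the dual variable, since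
    the blocks of [S *m y] sum to zero; this determines the common block of [z]
    from that of [w], and the proximal equation then says that the latter is
    stationary. *)
Lemma fixed_point_stationary (w y z : 'cV[R]_(K * M)) :
  fixed_point A mu J r w y z ->
  exists2 a, stationary (mean_cost J) r a &
    w = stack (fun _ => a) /\ z = stack (fun _ => a - mu *: gradJ a).
Proof.
move=> [zE Sz0 w_prox]; pose k0 := Ordinal K_gt0.
have consensus (x : 'cV[R]_(K * M)) : (forall k l, block x k = block x l) ->
    x = stack (fun _ => block x k0).
  by move=> xk; apply: eq_block => k; rewrite block_stack.
have z_stack := consensus _
  (ker_netB_sqrt_consensus A_sym A_ds A_prim (esym Sz0)).
rewrite z_stack in w_prox.
have w_stack := consensus _ (prox_netR_consensus w_prox).
move: (block z k0) (block w k0) z_stack w_stack w_prox.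
move=> z0 a z_stack w_stack w_prox.
have Sw0 : psd_sqrt (netB A M) *m w = 0.
  by rewrite w_stack; exact: consensus_ker_netB_sqrt.
have z0E : z0 = a - mu *: gradJ a.
  apply: (@scalerI _ _ K%:R) => //.
  have : \sum_k block z k = K%:R *: z0.
    rewrite z_stack scaler_nat -[in RHS](card_ord K) -sumr_const.
    by apply: eq_bigr => k _; rewrite block_stack.
  move=> <-; rewrite zE (grad_netJmu J_diff) //.
  under eq_bigr do rewrite !blockB blockZ block_stack {1}w_stack block_stack.
  rewrite sumrB netB_sqrt_sum_block // subr0 sumrB sumr_const card_ord.
  rewrite scalerBr scaler_nat; congr (_ - _).
  rewrite -scaler_sumr scalerA mulrC -scalerA -sum_gradE; congr (_ *: _).
  by apply: eq_bigr => k _; rewrite w_stack block_stack.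
exists a; last by rewrite -z0E.
rewrite w_stack in w_prox => u.
have a_min := prox_netR_argmin K_gt0 r_proper w_prox.
have := argmin_first_order (u := u) r_proper r_convex a_min; apply.
have -> : dotv (u - a) (grad (mean_cost J) a) =
    (2 * mu)^-1 *: (2 * dotv (1%:M *m (u - a)) (1%:M *m a - z0)).
  have -> : 1%:M *m a - z0 = mu *: gradJ a.
    by rewrite mul1mx z0E opprB addrC subrK.
  rewrite mul1mx dotvZr /GRing.scale /=.
  by field; rewrite gt_eqF.
have -> : (fun x => (2 * mu)^-1 * norm2 (x - z0) ^+ 2) =
    (2 * mu)^-1 *: (fun x => norm2 (1%:M *m x - z0) ^+ 2).
  by apply/funext => x; rewrite fctE mul1mx.
by apply: is_deriveZ; exact: is_derive_norm2_affine.
Qed.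

Lemma argmin_stationary a : argmin (objective J r) a ->
  stationary (mean_cost J) r a.
Proof.
move=> a_min u.
have a_min' : argmin (fun x => r x + (mean_cost J x)%:E)%E a.
  by move=> x; rewrite ![(r _ + _)%E]addeC; exact: a_min.
apply: (argmin_first_order r_proper r_convex a_min').
exact: is_derive_mean_cost.
Qed.

(** The blocks of [w - mu grad J - z] are [mu (gradJ a - grad (J k) a)].  They
    sum to zero, so they come from some [y]; and the choice of [z] makes the
    subgradient required by the proximal equation be [- gradJ a] in each
    block. *)
Lemma stationary_fixed_point a : stationary (mean_cost J) r a ->
  exists w y z : 'cV[R]_(K * M), fixed_point A mu J r w y z.
Proof.
move=> a_stat; have [s ra] := stationary_finite r_proper a_stat.
pose w : 'cV[R]_(K * M) := stack (fun _ => a).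
pose z : 'cV[R]_(K * M) := stack (fun _ => a - mu *: gradJ a).
have Sw0 : psd_sqrt (netB A M) *m w = 0 by exact: consensus_ker_netB_sqrt.
have [|y Sy] := @netB_sqrt_range R K M A A_sym A_ds
    (w - mu *: grad (netJmu A mu J) w - z) A_prim K_gt0.
  rewrite (grad_netJmu J_diff) //.
  under eq_bigr do
    rewrite !blockB blockZ !block_stack opprB addrAC addrCA subrr addr0.
  by rewrite sumrB -!scaler_sumr sum_gradE sumr_const card_ord scaler_nat subrr.
exists w, y, z; split.
- by rewrite Sy opprB addrC subrK.
- by rewrite consensus_ker_netB_sqrt.
apply: (@prox_subgradient _ _ _ _ _ _ (K%:R * s)) => //.
  by rewrite netR_stack ra sume_const.
move=> u.
have -> : K%:R * s + mu^-1 * dotv (z - w) (u - w) =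
    \sum_(k < K) (s - dotv (block u k - a) (gradJ a)).
  rewrite dotv_block sumrB sumr_const card_ord mulr_natl; congr (_ + _).
  rewrite mulr_sumr -sumrN; apply: eq_bigr => k _.
  rewrite !blockB !block_stack addrAC subrr add0r dotvNl dotvZl.
  by rewrite dotvC mulrN mulKf ?gt_eqF.
rewrite -sumEFin; apply: lee_sum => k _.
have := a_stat (block u k); rewrite ra.
case: (r _) (r_proper.1 (block u k)) => [t| |] // _.
  2: by move=> _; exact: leey.
by rewrite -EFinD !lee_fin lerBlDr.
Qed.

End FixedPoints.

Theorem lemma1 (R : realType) (K M : nat) (mu nu delta : R)
    (J : 'I_K -> 'cV[R]_M -> R) (r : 'cV[R]_M -> \bar R) (A : 'M[R]_K)
    (K_gt0 : (0 < K)%N)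
    (mu_gt0 : 0 < mu)
    (J_convex : forall k, convex_function setT (J k))
    (J_differentiable : forall k x, differentiable (J k) x)
    (J_lipschitz_grad : forall k (u v : 'cV[R]_M),
       norm2 (grad (J k) u - grad (J k) v) <= delta * norm2 (u - v))
    (nu_gt0 : 0 < nu)
    (nu_le_delta : nu <= delta)
    (mean_strongly_convex : forall u v : 'cV[R]_M,
       nu * norm2 (u - v) ^+ 2 <=
       dotv (u - v) (grad (mean_cost J) u - grad (mean_cost J) v))
    (r_proper : eproper r)
    (r_lsc : lower_semicontinuous r)
    (r_convex : econvex r)
    (has_solution : argmin (objective J r) !=set0)
    (A_symmetric : A^T = A)
    (A_doubly_stochastic : doubly_stochastic A)
    (A_primitive : primitive_mx A) :
  [/\ exists w y z : 'cV[R]_(K * M), fixed_point A mu J r w y z,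
      forall w y z w' y' z' : 'cV[R]_(K * M),
        fixed_point A mu J r w y z -> fixed_point A mu J r w' y' z' ->
        w = w' /\ z = z' &
      exists2 wstar : 'cV[R]_M, argmin (objective J r) = [set wstar] &
        forall w y z : 'cV[R]_(K * M), fixed_point A mu J r w y z ->
        forall k : 'I_K, block w k = wstar].
Proof.
have [wstar wstar_min] := has_solution.
have opt a : argmin (objective J r) a -> stationary (mean_cost J) r a.
  exact: argmin_stationary.
have wstar_stat := opt _ wstar_min.
have uniq a : stationary (mean_cost J) r a -> a = wstar.
  move=> a_stat.
  exact: (stationary_unique nu_gt0 mean_strongly_convex r_proper).
have fixedE (w y z : 'cV[R]_(K * M)) : fixed_point A mu J r w y z ->
    w = stack (fun _ => wstar) /\
    z = stack (fun _ => wstar - mu *: grad (mean_cost J) wstar).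
  have fp_stat := @fixed_point_stationary R K M mu J r A K_gt0 mu_gt0
    J_differentiable r_proper r_convex A_symmetric A_doubly_stochastic
    A_primitive w y z.
  by case/fp_stat => a /uniq -> [-> ->].
split.
- exact: stationary_fixed_point wstar_stat.
- by move=> w y z w' y' z' /fixedE[-> ->] /fixedE[-> ->].
exists wstar; last by move=> w y z /fixedE[-> _] k; rewrite block_stack.
apply/seteqP; split => [a /opt/uniq //|a /= ->].
exact: wstar_min.
Qed.
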